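(* Let $(M_1,g_1)$, $(M_2,g_2)$ and $(M_3,g_3)$ be Riemannian manifolds, let $f$ be a positive smooth function on $M_1$, and let $M=M_1\times_f M_2$ be the warped product manifold with metric $g=g_1+f^2g_2$. Let $\pi_2:M_1\times M_2\to M_2$ be the second canonical projection. If $f_1$ is a Riemannian submersion from $M_2$ onto $M_3$, then $f_2=f_1\circ\pi_2:M\to M_3$ is a horizontally conformal submersion.
   Context: The warped product $M_1\times_f M_2$ is the product manifold $M_1\times M_2$ with the metric $g(X,Y)=g_1(\pi_{1*}X,\pi_{1*}Y)+f^2(\pi_1(\cdot))\,g_2(\pi_{2*}X,\pi_{2*}Y)$, where $\pi_1,\pi_2$ are the canonical projections. A Riemannian submersion $F:(M,g_M)\to(N,g_N)$ is a smooth surjective map of maximal rank (i.e. $F_*$ is surjective at every point) such that $F_*$ preserves the lengths of horizontal vectors, i.e. of vectors in $(\ker F_* )^\perp$. A horizontally conformal submersion $F:(M,g_M)\to(N,g_N)$ is a smooth surjective map of maximal rank for which there exists $\lambda\in C^\infty(M)$ such that $g_M(X,Y)=e^{2\lambda(p)}g_N(F_*X,F_*Y)$ for all $p\in M$ and all horizontal vectors $X,Y\in(\ker F_{*})^\perp_p$. *)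

(* Defs.v *)
From HB Require Import structures.
From mathcomp Require Import all_boot all_order all_algebra.
From mathcomp Require Import ring.
From mathcomp Require Import all_classical all_reals all_analysis.

Set Implicit Arguments.
Unset Strict Implicit.
Unset Printing Implicit Defensive.

Import Order.TTheory GRing.Theory Num.Theory.
Import numFieldNormedType.Exports.

Local Open Scope classical_set_scope.
Local Open Scope ring_scope.

(* Only meant for open U: C^(k+1) means Fréchet differentiable on U with all
   directional derivatives of class C^k, which for finite-dimensional V is the
   usual class C^(k+1). *)
Fixpoint Ck_on (R : realType) (V W : normedModType R) (k : nat) (U : set V)
    (f : V -> W) : Prop :=
  match k with
  | 0 => forall x, U x -> {for x, continuous f}
  | k'.+1 => (forall x, U x -> differentiable f x) /\
             (forall v, Ck_on k' U (fun x => 'D_v f x))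
  end.

Definition smooth_on (R : realType) (V W : normedModType R) (U : set V)
  (f : V -> W) : Prop := forall k, Ck_on k U f.

(* A homeomorphism from an open subset cdom of T onto an open subset of R^n;
   cmap and cinv are junk outside cdom and cmap @` cdom respectively. *)
Record chart (R : realType) (T : topologicalType) (n : nat) := Chart {
  cdom : set T;
  cmap : T -> 'rV[R]_n;
  cinv : 'rV[R]_n -> T;
  cdom_open : open cdom;
  cimg_open : open (cmap @` cdom);
  cmapK : forall p, cdom p -> cinv (cmap p) = p;
  cmap_continuous : forall p, cdom p -> {for p, continuous cmap};
  cinv_continuous : forall x, (cmap @` cdom) x -> {for x, continuous cinv}
}.

Definition cimg (R : realType) (T : topologicalType) (n : nat)
  (c : chart R T n) : set 'rV[R]_n := cmap c @` cdom c.

(* chart_at is a choice of a chart around each point; it only serves to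
   represent tangent vectors (see tangent below). *)
Record manifold (R : realType) (n : nat) := Manifold {
  mpoints :> topologicalType;
  manifold_nonempty : [set: mpoints] !=set0;
  manifold_hausdorff : hausdorff_space mpoints;
  manifold_second_countable : @second_countable mpoints;
  atlas : set (chart R mpoints n);
  chart_at : mpoints -> chart R mpoints n;
  atlas_chart_at : forall p, atlas (chart_at p);
  chart_at_dom : forall p, cdom (chart_at p) p;
  atlas_compat : forall c d, atlas c -> atlas d ->
    smooth_on (cmap c @` (cdom c `&` cdom d)) (cmap d \o cinv c)
}.

Definition smooth_fun (R : realType) (n : nat) (M : manifold R n)
  (f : M -> R) : Prop :=
  forall c, atlas c -> smooth_on (cimg c) (f \o cinv c).

Definition smooth_map (R : realType) (m n : nat) (M : manifold R m)
    (N : manifold R n) (F : M -> N) : Prop :=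
  continuous F /\
  forall c d, atlas c -> atlas d ->
    smooth_on (cmap c @` (cdom c `&` F @^-1` cdom d)) (cmap d \o F \o cinv c).

(* A tangent vector at p is represented by its components in the coordinate
   basis of chart_at p. *)
Definition tangent (R : realType) (n : nat) (M : manifold R n) (p : M) :
  normedModType R := 'rV[R]_n.

(* The differential F_* at p, for F smooth, in the charts chart_at p and
   chart_at (F p). *)
Definition tmap (R : realType) (m n : nat) (M : manifold R m)
    (N : manifold R n) (F : M -> N) (p : M) :
    {linear tangent p -> tangent (F p)} :=
  'd (cmap (chart_at (F p)) \o F \o cinv (chart_at p)) (cmap (chart_at p) p).

(* The tangent vector \sum_i v_i d/dx^i at p, for x the coordinates of c. *)
Definition coord_vec (R : realType) (n : nat) (M : manifold R n)
    (c : chart R M n) (p : M) (v : 'rV[R]_n) : tangent p :=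
  'd (cmap (chart_at p) \o cinv c) (cmap c p) v.

(* In metric_smooth, u and v range over constant coefficient vectors: u and v in
   the canonical basis give the usual components g_ij of the metric. *)
Record metric (R : realType) (n : nat) (M : manifold R n) := Metric {
  metric_val :> forall p : M, tangent p -> tangent p -> R;
  metric_linear : forall (p : M) (a : R) (X Y Z : tangent p),
    metric_val (a *: X + Y) Z = a * metric_val X Z + metric_val Y Z;
  metric_sym : forall (p : M) (X Y : tangent p),
    metric_val X Y = metric_val Y X;
  metric_pos : forall (p : M) (X : tangent p), X != 0 -> 0 < metric_val X X;
  metric_smooth : forall c, atlas c -> forall u v : 'rV[R]_n,
    smooth_on (cimg c) (fun x => metric_val (coord_vec c (cinv c x) u)
                                            (coord_vec c (cinv c x) v))
}.

Record riemannian (R : realType) (n : nat) := Riemannian {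
  rmanifold :> manifold R n;
  rmetric : metric rmanifold
}.

Section Submersions.
Context (R : realType) (m n : nat) (M : riemannian R m) (N : riemannian R n).
Implicit Type F : M -> N.

Definition smooth_submersion F : Prop :=
  [/\ smooth_map F, (forall q : N, exists p : M, F p = q) &
      forall (p : M) (Y : tangent (F p)), exists X, tmap F p X = Y].

Definition horizontal F (p : M) (X : tangent p) : Prop :=
  forall V : tangent p, tmap F p V = 0 -> rmetric M p X V = 0.

Definition riemannian_submersion F : Prop :=
  smooth_submersion F /\
  forall (p : M) (X : tangent p), horizontal F X ->
    Num.sqrt (rmetric N (F p) (tmap F p X) (tmap F p X)) = Num.sqrt (rmetric M p X X).

Definition horizontally_conformal_submersion F : Prop :=
  smooth_submersion F /\
  exists2 lambda : M -> R, smooth_fun lambda &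
    forall (p : M) (X Y : tangent p), horizontal F X -> horizontal F Y ->
      rmetric M p X Y =
        expR (2 * lambda p) * rmetric N (F p) (tmap F p X) (tmap F p Y).

End Submersions.

Section Calculus.
Context {R : realType}.
Implicit Types V W : normedModType R.

Lemma near_eq_diff V W (f g : V -> W) (x : V) :
  (\forall y \near x, f y = g y) -> differentiable g x ->
  differentiable f x /\ 'd f x = 'd g x :> (V -> W).
Proof.
move=> fg dg.
have fgx : f x = g x by exact: nbhs_singleton fg.
have gE : g \o shift x = cst (g x) + 'd g x +o_ 0 id by exact: diff_locally.
have fE : f \o shift x = cst (f x) + 'd g x +o_ 0 id.
  apply/eqaddoP => e e0; move/eqaddoP: gE => /(_ e e0).
  apply: filter_app.
  move: fg; rewrite (near_shift 0 x) subr0.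
  apply: filterS => h /= fgh; rewrite -fgx => H; move: H.
  rewrite -![(_ + _ : _ -> _) _]/(_ + _) /=
      -![(- _ : _ -> _) _]/(- _) /= fgh //.
have dfE := diff_unique (diff_continuous dg) fE.
split => //; apply/diff_locallyP; rewrite dfE; split => //.
exact: diff_continuous.
Qed.

Lemma near_open V W (f g : V -> W) (U : set V) x : open U -> U x ->
  (forall x, U x -> f x = g x) -> \forall y \near x, f y = g y.
Proof.
move=> oU Ux fg; apply: (@filterS _ _ _ U) => //.
exact: open_nbhs_nbhs.
Qed.

Lemma Ck_on_eq V W k (U : set V) (f g : V -> W) : open U ->
  (forall x, U x -> f x = g x) -> Ck_on k U g -> Ck_on k U f.
Proof.
move=> oU; elim: k f g => [|k IH] f g fg /=.
  move=> cg x Ux; have nfg := near_open oU Ux fg.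
  suff : f @ x --> f x by [].
  rewrite (fg x Ux); apply: cvg_trans (cg x Ux); apply: near_eq_cvg.
  by apply: filterS nfg => y ->.
move=> [dg cg]; split=> [x Ux|v].
  by have [] := near_eq_diff (near_open oU Ux fg) (dg x Ux).
apply: IH (cg v) => x Ux; apply: near_eq_derive.
exact: near_open oU Ux fg.
Qed.

Lemma Ck_on_sub V W k (U U' : set V) (f : V -> W) : U' `<=` U ->
  Ck_on k U f -> Ck_on k U' f.
Proof.
move=> sU; elim: k f => [|k IH] f /=; first by move=> cf x /sU /cf.
by move=> [df cf]; split=> [x /sU /df|v]; [|exact: IH].
Qed.

Lemma Ck_on_pred V W k (U : set V) (f : V -> W) :
  Ck_on k.+1 U f -> Ck_on k U f.
Proof.
elim: k f => [|k IH] f; first by move=> [df _] x /df /differentiable_continuous.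
by move=> [df cf]; split => // v; apply/IH/cf.
Qed.

Lemma Ck_on_cst V W k (U : set V) (a : W) : Ck_on k U (fun=> a).
Proof.
elim: k a => [|k IH] a /=; first by move=> x _; exact: cvg_cst.
split=> [x _|v]; first exact: differentiable_cst.
have -> : (fun x => 'D_v (fun=> a) x) = (fun=> 0) :> (V -> W).
  by rewrite funeqE => x; exact: derive_cst.
exact: IH.
Qed.

Lemma Ck_on_add V W k (U : set V) (f g : V -> W) : open U ->
  Ck_on k U f -> Ck_on k U g -> Ck_on k U (fun x => f x + g x).
Proof.
move=> oU; elim: k f g => [|k IH] f g /=.
  by move=> cf cg x Ux; apply: cvgD; [exact: cf|exact: cg].
move=> [df cf] [dg cg]; split=> [x Ux|v].
  by apply: differentiableD; [exact: df|exact: dg].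
apply: (Ck_on_eq oU _ (IH _ _ (cf v) (cg v))) => x Ux.
by apply: deriveD; apply: diff_derivable; [exact: df|exact: dg].
Qed.

Lemma Ck_on_mul V k (U : set V) (f g : V -> R) : open U ->
  Ck_on k U f -> Ck_on k U g -> Ck_on k U (fun x => f x * g x).
Proof.
move=> oU; elim: k f g => [|k IH] f g.
  by move=> cf cg x Ux; apply: cvgM; [exact: cf|exact: cg].
move=> Cf Cg; have [df cf] := Cf; have [dg cg] := Cg; split=> [x Ux|v].
  by apply: differentiableM; [exact: df|exact: dg].
have := Ck_on_add oU (IH _ _ (Ck_on_pred Cf) (cg v))
  (IH _ _ (Ck_on_pred Cg) (cf v)).
apply: Ck_on_eq => // x Ux.
by apply: deriveM; apply: diff_derivable; [exact: df|exact: dg].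
Qed.

Lemma Ck_on_lin_comp V W (W' : normedModType R) k (U : set V)
    (L : {linear W -> W'}) (f : V -> W) : open U -> continuous L ->
  Ck_on k U f -> Ck_on k U (fun x => L (f x)).
Proof.
move=> oU cL; elim: k f => [|k IH] f.
  by move=> cf x Ux; apply: continuous_comp; [exact: cf|exact: cL].
have dL y : differentiable L y by exact: linear_differentiable.
move=> [df cf]; split=> [x Ux|v].
  by apply: differentiable_comp => //; exact: df.
have := IH _ (cf v); apply: Ck_on_eq => // x Ux.
rewrite (deriveE _ (df x Ux)) deriveE; last first.
  by apply: differentiable_comp => //; exact: df.
rewrite (_ : (fun _ => _) = L \o f)// diff_comp//; last exact: df.
by rewrite /= diff_lin.
Qed.

Lemma Ck_on_comp_lin V (V' : normedModType R) W k (U : set V)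
    (L : {linear V' -> V}) (f : V -> W) : open U -> continuous L ->
  Ck_on k U f -> Ck_on k (L @^-1` U) (fun x => f (L x)).
Proof.
move=> oU cL; have oLU : open (L @^-1` U) by exact: (continuousP _).1.
elim: k f => [|k IH] f.
  by move=> cf x Ux; apply: continuous_comp; [exact: cL|exact: cf].
have dL y : differentiable L y by exact: linear_differentiable.
move=> [df cf]; split=> [x Ux|v].
  by apply: differentiable_comp => //; exact: df.
have := IH _ (cf (L v)); apply: Ck_on_eq => // x Ux.
rewrite (deriveE _ (df _ Ux)) deriveE; last first.
  by apply: differentiable_comp => //; exact: df.
rewrite (_ : (fun _ => _) = f \o L)// diff_comp//; last exact: df.
by rewrite /= diff_lin.
Qed.

Lemma diff_lin_comp_lin (V V' W W' : normedModType R) (K : {linear V' -> V})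
    (L : {linear W -> W'}) (f : V -> W) x w : continuous K -> continuous L ->
  differentiable f (K x) ->
  'd (L \o (f \o K)) x w = L ('d f (K x) (K w)).
Proof.
move=> cK cL df.
have dK : differentiable K x by exact: linear_differentiable.
have dL : differentiable L ((f \o K) x) by exact: linear_differentiable.
have dfK : differentiable (f \o K) x by exact: differentiable_comp.
by rewrite (diff_comp dfK dL) (diff_comp dK df) /= !diff_lin.
Qed.

End Calculus.

Section RowBlocks.
Context {R : realType} {m n : nat}.

Definition rowl (a : 'rV[R]_m) : 'rV[R]_(m + n) := row_mx a 0.
Definition rowr (b : 'rV[R]_n) : 'rV[R]_(m + n) := row_mx 0 b.

Fact rowl_linear : linear rowl.
Proof. by move=> a u v; rewrite /rowl scale_row_mx add_row_mx scaler0 addr0. Qed.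
Fact rowr_linear : linear rowr.
Proof. by move=> a u v; rewrite /rowr scale_row_mx add_row_mx scaler0 addr0. Qed.

HB.instance Definition _ :=
  GRing.isLinear.Build R 'rV[R]_m 'rV[R]_(m + n) _ rowl rowl_linear.
HB.instance Definition _ :=
  GRing.isLinear.Build R 'rV[R]_n 'rV[R]_(m + n) _ rowr rowr_linear.

Lemma row_mx_rowD (a : 'rV[R]_m) (b : 'rV[R]_n) : row_mx a b = rowl a + rowr b.
Proof. by rewrite /rowl /rowr add_row_mx addr0 add0r. Qed.

Lemma continuous_rowl : continuous rowl.
Proof.
move=> u A /nbhs_ballP[e /= e0 eA].
apply/nbhs_ballP; exists e => //= v [_ uv]; apply: eA; split => // i j.
rewrite /rowl; case: (splitP j) => k jk.
  by rewrite (_ : j = lshift n k) ?row_mxEl//; exact: val_inj.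
rewrite (_ : j = rshift m k); last exact: val_inj.
by rewrite !row_mxEr; exact: ballxx.
Qed.

Lemma continuous_rowr : continuous rowr.
Proof.
move=> u A /nbhs_ballP[e /= e0 eA].
apply/nbhs_ballP; exists e => //= v [_ uv]; apply: eA; split => // i j.
rewrite /rowr; case: (splitP j) => k jk.
  rewrite (_ : j = lshift n k); last exact: val_inj.
  by rewrite !row_mxEl; exact: ballxx.
by rewrite (_ : j = rshift m k) ?row_mxEr//; exact: val_inj.
Qed.

Lemma continuous_row_mx (T : topologicalType) (f : T -> 'rV[R]_m)
    (g : T -> 'rV[R]_n) x : {for x, continuous f} -> {for x, continuous g} ->
  {for x, continuous (fun y => row_mx (f y) (g y))}.
Proof.
move=> cf cg; rewrite (_ : (fun y => _) = fun y => rowl (f y) + rowr (g y)); last first.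
  by rewrite funeqE => y; rewrite row_mx_rowD.
have cl : (fun y => rowl (f y)) @ x --> rowl (f x).
  exact: (continuous_comp cf (@continuous_rowl (f x))).
have cr : (fun y => rowr (g y)) @ x --> rowr (g x).
  exact: (continuous_comp cg (@continuous_rowr (g x))).
exact: (cvgD cl cr).
Qed.

End RowBlocks.

Section RowBlocks2.
Context {R : realType}.

Lemma smooth_on_row_mx m n p q (U : set 'rV[R]_m) (V : set 'rV[R]_n)
    (f : 'rV[R]_m -> 'rV[R]_p) (g : 'rV[R]_n -> 'rV[R]_q) :
  open U -> open V -> smooth_on U f -> smooth_on V g ->
  smooth_on (lsubmx @^-1` U `&` rsubmx @^-1` V)
    (fun x : 'rV[R]_(m + n) => row_mx (f (lsubmx x)) (g (rsubmx x))).
Proof.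
move=> oU oV sf sg k.
have oU' : open ((lsubmx : 'rV[R]_(m + n) -> 'rV[R]_m) @^-1` U).
  by apply: (continuousP _).1 => //; exact: continuous_lsubmx.
have oV' : open ((rsubmx : 'rV[R]_(m + n) -> 'rV[R]_n) @^-1` V).
  by apply: (continuousP _).1 => //; exact: continuous_rsubmx.
have oUV := openI oU' oV'.
rewrite (_ : (fun x => _) = fun x =>
  rowl (f (lsubmx x)) + rowr (g (rsubmx x))); last first.
  by rewrite funeqE => y; rewrite row_mx_rowD.
apply: Ck_on_add => //.
  apply: (Ck_on_lin_comp oUV (@continuous_rowl R p q)).
  apply: (@Ck_on_sub _ _ _ _ (lsubmx @^-1` U)); first by move=> x [].
  exact: (@Ck_on_comp_lin R _ _ _ k U lsubmx f oU (@continuous_lsubmx _ _ _ _)).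
apply: (Ck_on_lin_comp oUV (@continuous_rowr R p q)).
apply: (@Ck_on_sub _ _ _ _ (rsubmx @^-1` V)); first by move=> x [].
exact: (@Ck_on_comp_lin R _ _ _ k V rsubmx g oV (@continuous_rsubmx _ _ _ _)).
Qed.

Lemma diff_row_mx m n p q (f : 'rV[R]_m -> 'rV[R]_p) (g : 'rV[R]_n -> 'rV[R]_q)
    (z : 'rV[R]_(m + n)) :
  differentiable f (lsubmx z) -> differentiable g (rsubmx z) ->
  forall w, 'd (fun x : 'rV[R]_(m + n) => row_mx (f (lsubmx x)) (g (rsubmx x)))
    z w = row_mx ('d f (lsubmx z) (lsubmx w)) ('d g (rsubmx z) (rsubmx w)).
Proof.
move=> df dg w.
rewrite (_ : (fun x => _) = (rowl \o (f \o lsubmx)) + (rowr \o (g \o rsubmx)));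
  last by rewrite funeqE => y; rewrite row_mx_rowD.
have dl y : differentiable (lsubmx : 'rV[R]_(m + n) -> _) y.
  exact: differentiable_lsubmx.
have dr y : differentiable (rsubmx : 'rV[R]_(m + n) -> _) y.
  exact: differentiable_rsubmx.
have dL y : differentiable (@rowl R p q) y.
  by apply: linear_differentiable; exact: continuous_rowl.
have dR y : differentiable (@rowr R p q) y.
  by apply: linear_differentiable; exact: continuous_rowr.
have dfl : differentiable (f \o lsubmx) z by exact: differentiable_comp.
have dgr : differentiable (g \o rsubmx) z by exact: differentiable_comp.
rewrite diffD; [|exact: differentiable_comp|exact: differentiable_comp].
rewrite row_mx_rowD; congr (_ + _).
  exact: (@diff_lin_comp_lin _ _ _ _ _ _ _ _ _ _
    (@continuous_lsubmx R 1 m n) (@continuous_rowl R p q) df).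
exact: (@diff_lin_comp_lin _ _ _ _ _ _ _ _ _ _
  (@continuous_rsubmx R 1 m n) (@continuous_rowr R p q) dg).
Qed.

End RowBlocks2.

Section ProductTopology.
Context {T U : topologicalType}.

Lemma open_setX (A : set T) (B : set U) : open A -> open B -> open (A `*` B).
Proof.
move=> oA oB; rewrite openE => -[x y] [/= Ax By].
by exists (A, B) => //; split; exact: open_nbhs_nbhs.
Qed.

Lemma hausdorff_prod : hausdorff_space T -> hausdorff_space U ->
  hausdorff_space (T * U)%type.
Proof.
move=> hT hU [x1 x2] [y1 y2] cl; congr (_, _).
  apply: hT => A B Ax By.
  have [||z [[Az _] [Bz _]]] := cl (A `*` setT) (B `*` setT).
  - by exists (A, setT) => //; split => //; exact: filterT.
  - by exists (B, setT) => //; split => //; exact: filterT.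
  by exists z.1.
apply: hU => A B Ax By.
have [||z [[_ Az] [_ Bz]]] := cl (setT `*` A) (setT `*` B).
- by exists (setT, A) => //; split => //; exact: filterT.
- by exists (setT, B) => //; split => //; exact: filterT.
by exists z.2.
Qed.

Lemma second_countable_prod : @second_countable T -> @second_countable U ->
  @second_countable (T * U)%type.
Proof.
move=> [B1 cB1 [oB1 bB1]] [B2 cB2 [oB2 bB2]].
exists [set A `*` B | A in B1 & B in B2].
  rewrite (_ : image2 _ _ _ = (fun AB => AB.1 `*` AB.2) @` (B1 `*` B2)).
    by apply: (sub_countable (card_image_le _ _)); exact: countableX.
  apply/seteqP; split=> [_ [A BA [B BB <-]]|_ [[A B] [BA BB] <-]].
    by exists (A, B).
  by exists A => //; exists B.
split=> [_ [A BA [B BB <-]]|[x y] C [[P Q] [/= Px Qy] PQC]].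
  by apply: open_setX; [exact: oB1|exact: oB2].
have [A [BA Ax] AP] := bB1 x P Px.
have [B [BB By] BQ] := bB2 y Q Qy.
exists (A `*` B); first by split; [exists A => //; exists B|].
by move=> z [Az Bz]; apply: PQC; split; [exact: AP|exact: BQ].
Qed.

End ProductTopology.

Section ProductChart.
Context {R : realType} {T1 T2 : topologicalType} {n1 n2 : nat}.
Context (c1 : chart R T1 n1) (c2 : chart R T2 n2).

Let dom : set (T1 * T2) := cdom c1 `*` cdom c2.
Let map (p : T1 * T2) : 'rV[R]_(n1 + n2) :=
  row_mx (cmap c1 p.1) (cmap c2 p.2).
Let inv (x : 'rV[R]_(n1 + n2)) : T1 * T2 :=
  (cinv c1 (lsubmx x), cinv c2 (rsubmx x)).

Fact prod_chart_img :
  map @` dom = lsubmx @^-1` cimg c1 `&` rsubmx @^-1` cimg c2.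
Proof.
apply/seteqP; split=> [_ [p [d1 d2] <-]|x [[p1 d1 e1] [p2 d2 e2]]].
  by split; rewrite /= /map ?row_mxKl ?row_mxKr; [exists p.1|exists p.2].
by exists (p1, p2) => //; rewrite /map /= e1 e2 hsubmxK.
Qed.

Fact prod_chart_dom_open : open dom.
Proof. by apply: open_setX; exact: cdom_open. Qed.

Fact prod_chart_img_open : open (map @` dom).
Proof.
rewrite prod_chart_img; apply: openI.
  apply: (continuousP _).1; last exact: cimg_open.
  exact: continuous_lsubmx.
apply: (continuousP _).1; last exact: cimg_open.
exact: continuous_rsubmx.
Qed.

Fact prod_chartK p : dom p -> inv (map p) = p.
Proof.
by case: p => p1 p2 [/= d1 d2]; rewrite /inv /map row_mxKl row_mxKr !cmapK.
Qed.

Fact prod_chart_map_continuous p : dom p -> {for p, continuous map}.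
Proof.
case: p => p1 p2 [/= d1 d2]; apply: continuous_row_mx.
  exact: (@continuous_comp _ _ _ fst (cmap c1) (p1, p2) (@cvg_fst _ _ _ _ _)
    (cmap_continuous d1)).
exact: (@continuous_comp _ _ _ snd (cmap c2) (p1, p2) (@cvg_snd _ _ _ _ _)
  (cmap_continuous d2)).
Qed.

Fact prod_chart_inv_continuous x :
  (map @` dom) x -> {for x, continuous inv}.
Proof.
rewrite prod_chart_img => -[d1 d2].
have k1 : (fun y : 'rV[R]_(n1 + n2) => cinv c1 (lsubmx y)) @ x -->
    cinv c1 (lsubmx x).
  exact: (@continuous_comp _ _ _ _ (cinv c1) x (@continuous_lsubmx _ _ _ _ x)
    (cinv_continuous d1)).
have k2 : (fun y : 'rV[R]_(n1 + n2) => cinv c2 (rsubmx y)) @ x -->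
    cinv c2 (rsubmx x).
  exact: (@continuous_comp _ _ _ _ (cinv c2) x (@continuous_rsubmx _ _ _ _ x)
    (cinv_continuous d2)).
exact: (cvg_pair k1 k2).
Qed.

Definition prod_chart : chart R (T1 * T2)%type (n1 + n2) :=
  Chart prod_chart_dom_open prod_chart_img_open prod_chartK
    prod_chart_map_continuous prod_chart_inv_continuous.

End ProductChart.

Section ProductManifold.
Context {R : realType} {n1 n2 : nat}.
Context (M1 : manifold R n1) (M2 : manifold R n2).

Definition prod_atlas : set (chart R (M1 * M2)%type (n1 + n2)) :=
  [set prod_chart c1 c2 | c1 in @atlas _ _ M1 & c2 in @atlas _ _ M2].

Definition prod_chart_at (p : M1 * M2) : chart R (M1 * M2)%type (n1 + n2) :=
  prod_chart (chart_at p.1) (chart_at p.2).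

Fact prod_nonempty : [set: M1 * M2] !=set0.
Proof.
have [p1 _] := manifold_nonempty M1; have [p2 _] := manifold_nonempty M2.
by exists (p1, p2).
Qed.

Fact prod_atlas_chart_at p : prod_atlas (prod_chart_at p).
Proof.
by exists (chart_at p.1); [|exists (chart_at p.2)]; rewrite //;
  exact: atlas_chart_at.
Qed.

Fact prod_chart_at_dom p : cdom (prod_chart_at p) p.
Proof. by split; exact: chart_at_dom. Qed.

Lemma open_overlap n (M : manifold R n) (c d : chart R M n) :
  open (cmap c @` (cdom c `&` cdom d)).
Proof.
rewrite openE => _ [p [cp dp] <-].
have cx : (cmap c @` cdom c) (cmap c p) by exists p.
have H : nbhs (cmap c p) (cinv c @^-1` cdom d).
  apply: (cinv_continuous cx); rewrite cmapK//.
  by apply: open_nbhs_nbhs; split => //; exact: cdom_open.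
have H' : nbhs (cmap c p) (cmap c @` cdom c).
  by apply: open_nbhs_nbhs; split => //; exact: cimg_open.
apply: filterS (filterI H H') => x [/= dx [q cq qx]].
by exists q => //; split => //; rewrite -[q](cmapK cq) qx.
Qed.

Fact prod_atlas_compat c d : prod_atlas c -> prod_atlas d ->
  smooth_on (cmap c @` (cdom c `&` cdom d)) (cmap d \o cinv c).
Proof.
move=> [c1 ac1 [c2 ac2 <-]] [d1 ad1 [d2 ad2 <-]] k.
have := smooth_on_row_mx (@open_overlap _ M1 c1 d1) (@open_overlap _ M2 c2 d2)
  (atlas_compat ac1 ad1) (atlas_compat ac2 ad2) k.
apply: Ck_on_sub => _ [p [[/= p1 p2] [q1 q2]] <-].
by split => /=; rewrite ?row_mxKl ?row_mxKr; [exists p.1|exists p.2].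
Qed.

Definition prod_manifold : manifold R (n1 + n2) :=
  @Manifold R (n1 + n2) (M1 * M2)%type prod_nonempty
    (hausdorff_prod (@manifold_hausdorff _ _ M1) (@manifold_hausdorff _ _ M2))
    (second_countable_prod (@manifold_second_countable _ _ M1)
      (@manifold_second_countable _ _ M2))
    prod_atlas prod_chart_at prod_atlas_chart_at prod_chart_at_dom
    prod_atlas_compat.

End ProductManifold.

Section WarpedProduct.
Context {R : realType} {n1 n2 : nat}.
Context (M1 : riemannian R n1) (M2 : riemannian R n2).
Local Notation M := (prod_manifold M1 M2).

Lemma diff_cmap_cinv n (N : manifold R n) (c d : chart R N n) (p : N) :
  atlas c -> atlas d -> cdom c p -> cdom d p ->
  differentiable (cmap d \o cinv c) (cmap c p).
Proof.
move=> ac ad cp dp; have [+ _] := @atlas_compat _ _ _ _ _ ac ad 1%N.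
by apply; exists p.
Qed.

Lemma near_cmapK n (N : manifold R n) (p : N) :
  \forall x \near cmap (chart_at p) p,
    cmap (chart_at p) (cinv (chart_at p) x) = x.
Proof.
have : nbhs (cmap (chart_at p) p) (cimg (chart_at p)).
  apply: open_nbhs_nbhs; split; first exact: cimg_open.
  by exists p => //; exact: chart_at_dom.
by apply: filterS => _ [q dq <-]; rewrite cmapK.
Qed.

Lemma tmap_fst (p : M) (X : tangent p) :
  @tmap R (n1 + n2) n1 M M1 fst p X = lsubmx (X : 'rV[R]_(n1 + n2)).
Proof.
pose x := cmap (chart_at p) p.
have xl : lsubmx x = cmap (chart_at p.1) p.1 by rewrite /x /= row_mxKl.
have fE : \forall y \near x,
    (cmap (chart_at p.1) \o fst \o cinv (chart_at p)) y = lsubmx y.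
  have := @continuous_lsubmx R 1 n1 n2 x _; rewrite xl.
  by move=> /(_ _ (near_cmapK p.1)).
have cl := @continuous_lsubmx R 1 n1 n2.
have [_ dE] := near_eq_diff fE (linear_differentiable x cl).
by rewrite /tmap; rewrite -/x; rewrite dE (diff_lin _ cl).
Qed.

Lemma tmap_snd (p : M) (X : tangent p) :
  @tmap R (n1 + n2) n2 M M2 snd p X = rsubmx (X : 'rV[R]_(n1 + n2)).
Proof.
pose x := cmap (chart_at p) p.
have xl : rsubmx x = cmap (chart_at p.2) p.2 by rewrite /x /= row_mxKr.
have fE : \forall y \near x,
    (cmap (chart_at p.2) \o snd \o cinv (chart_at p)) y = rsubmx y.
  have := @continuous_rsubmx R 1 n1 n2 x _; rewrite xl.
  by move=> /(_ _ (near_cmapK p.2)).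
have cl := @continuous_rsubmx R 1 n1 n2.
have [_ dE] := near_eq_diff fE (linear_differentiable x cl).
by rewrite /tmap; rewrite -/x; rewrite dE (diff_lin _ cl).
Qed.

Lemma coord_vec_prod (c1 : chart R M1 n1) (c2 : chart R M2 n2) (p : M)
    (w : 'rV[R]_(n1 + n2)) : atlas c1 -> atlas c2 -> cdom c1 p.1 ->
    cdom c2 p.2 ->
  @coord_vec R (n1 + n2) M (prod_chart c1 c2) p w =
  row_mx (coord_vec c1 p.1 (lsubmx w) : 'rV[R]_n1)
         (coord_vec c2 p.2 (rsubmx w) : 'rV[R]_n2).
Proof.
move=> a1 a2 p1 p2.
pose x := cmap (prod_chart c1 c2) p.
have xl : lsubmx x = cmap c1 p.1 by rewrite /x /= row_mxKl.
have xr : rsubmx x = cmap c2 p.2 by rewrite /x /= row_mxKr.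
have := diff_cmap_cinv a1 (atlas_chart_at p.1) p1 (chart_at_dom p.1).
rewrite -xl => d1.
have := diff_cmap_cinv a2 (atlas_chart_at p.2) p2 (chart_at_dom p.2).
rewrite -xr => d2.
rewrite /coord_vec -xl -xr.
exact: (diff_row_mx d1 d2).
Qed.

Context (f : M1 -> R).

Definition warped_val (p : M) (X Y : tangent p) : R :=
  rmetric M1 (fst p) (@tmap R _ _ M M1 fst p X) (@tmap R _ _ M M1 fst p Y) +
  f (fst p) ^+ 2 *
    rmetric M2 (snd p) (@tmap R _ _ M M2 snd p X) (@tmap R _ _ M M2 snd p Y).

Context (f_smooth : smooth_fun f) (f_gt0 : forall p, 0 < f p).

Fact warped_linear (p : M) (a : R) (X Y Z : tangent p) :
  warped_val (a *: X + Y) Z = a * warped_val X Z + warped_val Y Z.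
Proof. by rewrite /warped_val !linearP !metric_linear; ring. Qed.

Fact warped_sym (p : M) (X Y : tangent p) : warped_val X Y = warped_val Y X.
Proof.
by rewrite /warped_val; congr (_ + _ * _); exact: metric_sym.
Qed.

Lemma metric_ge0 n (N : riemannian R n) (p : N) (X : tangent p) :
  0 <= rmetric N p X X.
Proof.
have [->|/metric_pos/ltW//] := eqVneq X 0.
have := @metric_linear _ _ _ (rmetric N) p (-1) 0 0 0.
by rewrite scaler0 addr0 mulN1r addNr => ->.
Qed.

Fact warped_pos (p : M) (X : tangent p) : X != 0 -> 0 < warped_val X X.
Proof.
move=> X0; rewrite /warped_val.
have [X1|X1] := eqVneq (@tmap R _ _ M M1 fst p X) 0; last first.
  apply: ltr_wpDr; last exact: metric_pos.
  by rewrite mulr_ge0 ?sqr_ge0//; exact: metric_ge0.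
apply: ltr_wpDl; first exact: metric_ge0.
rewrite mulr_gt0 ?exprn_gt0//; apply: metric_pos.
apply: contra_neq X0 => X2.
rewrite -[X](@hsubmxK R 1 n1 n2) -(tmap_fst X) -(tmap_snd X) X1 X2.
exact: row_mx0.
Qed.

Fact warped_smooth (c : chart R M (n1 + n2)) : atlas c ->
  forall u v : 'rV[R]_(n1 + n2),
  smooth_on (cimg c) (fun x => warped_val (coord_vec c (cinv c x) u)
                                          (coord_vec c (cinv c x) v)).
Proof.
move=> [c1 a1 [c2 a2 <-]] u v k.
have o1 : open (cimg c1) by exact: cimg_open.
have o2 : open (cimg c2) by exact: cimg_open.
have oU : open (cimg (prod_chart c1 c2)) by exact: cimg_open.
have imE := @prod_chart_img R M1 M2 n1 n2 c1 c2.
have s1 : cimg (prod_chart c1 c2) `<=` lsubmx @^-1` cimg c1.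
  by rewrite [cimg _]imE => x [].
have s2 : cimg (prod_chart c1 c2) `<=` rsubmx @^-1` cimg c2.
  by rewrite [cimg _]imE => x [].
have L (W : normedModType R) (h : 'rV[R]_n1 -> W) : Ck_on k (cimg c1) h ->
    Ck_on k (cimg (prod_chart c1 c2)) (fun x => h (lsubmx x)).
  move=> H; apply: (Ck_on_sub s1).
  exact: (@Ck_on_comp_lin R _ _ _ k _ lsubmx h o1 (@continuous_lsubmx _ _ _ _)).
have Q (W : normedModType R) (h : 'rV[R]_n2 -> W) : Ck_on k (cimg c2) h ->
    Ck_on k (cimg (prod_chart c1 c2)) (fun x => h (rsubmx x)).
  move=> H; apply: (Ck_on_sub s2).
  exact: (@Ck_on_comp_lin R _ _ _ k _ rsubmx h o2 (@continuous_rsubmx _ _ _ _)).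
have H1 := L _ _ (@metric_smooth _ _ _ (rmetric M1) _ a1 (lsubmx u) (lsubmx v) k).
have H2 := Q _ _ (@metric_smooth _ _ _ (rmetric M2) _ a2 (rsubmx u) (rsubmx v) k).
have H3 := L _ _ (f_smooth a1 k).
have := Ck_on_add oU H1 (Ck_on_mul oU (Ck_on_mul oU H3 H3) H2).
apply: (Ck_on_eq oU) => x Ux.
have [p1 d1 e1] := s1 _ Ux; have [p2 d2 e2] := s2 _ Ux.
have D1 : cdom c1 (cinv c1 (lsubmx x)) by rewrite -e1 cmapK.
have D2 : cdom c2 (cinv c2 (rsubmx x)) by rewrite -e2 cmapK.
rewrite /warped_val !tmap_fst !tmap_snd.
rewrite !(@coord_vec_prod c1 c2 (cinv (prod_chart c1 c2) x))//.
by rewrite !row_mxKl !row_mxKr expr2.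
Qed.

Definition warped_metric : metric M :=
  Metric warped_linear warped_sym warped_pos warped_smooth.

Definition warped_product : riemannian R (n1 + n2) := Riemannian warped_metric.

End WarpedProduct.

(* Main.v *)
Require Import Defs.
From mathcomp Require Import all_boot all_order all_algebra.
From mathcomp Require Import all_classical all_reals all_analysis.
From mathcomp Require Import ring lra.

(** The conformal factor is f itself: lambda = ln f on the first component, so
    that e^(2 lambda) = f^2.

    The differential of f1 \o snd sends (X1, X2) to f1_* X2
    ([tmap_comp_snd]).  Its kernel therefore contains every (V1, 0), and a
    horizontal vector, being orthogonal to all of them, has X1 = 0; being also
    orthogonal to all (0, V2) with f1_* V2 = 0, and f^2 being nonzero, it has
    X2 horizontal for f1 ([horizontal_comp_snd]).  On two horizontal vectors
    the warped metric thus reduces to f^2 g2(X2, Y2).  A Riemannian submersion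
    preserves lengths of horizontal vectors, hence, horizontal vectors being
    closed under addition, also their inner products by polarization
    ([riemannian_submersion_metric]), which gives f^2 g3(f1_* X2, f1_* Y2).

    In product charts snd and fst are the linear block projections, so the
    smoothness of f1 \o snd and of lambda comes from stability of C^k maps
    under precomposition with a linear map, together with stability of positive
    C^k functions under ln ([Ck_on_ln]). *)

Local Open Scope ring_scope.

Set Implicit Arguments.
Unset Strict Implicit.
Unset Printing Implicit Defensive.

Import Order.TTheory GRing.Theory Num.Theory.
Import numFieldNormedType.Exports.

Local Open Scope classical_set_scope.

(** The derivative of 1/h along v is - (1/h)^2 D_v h, in which 1/h itself
    reappears one order of differentiability lower: the induction closes. *)
Lemma Ck_on_inv (R : realType) (V : normedModType R) k (U : set V) (h : V -> R) :
  open U -> (forall x, U x -> h x != 0) ->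
  Ck_on k U h -> Ck_on k U (fun x => (h x)^-1).
Proof.
move=> oU h0; elim: k => [|k IH] Ch.
  by move=> x Ux; apply: cvgV; [exact: h0|exact: Ch].
have [dh ch] := Ch; split=> [x Ux|v].
  by apply: differentiableV; [exact: dh|exact: h0].
have CV := IH (Ck_on_pred Ch).
have CVV := Ck_on_mul oU (@Ck_on_cst R V R k U (-1)) (Ck_on_mul oU CV CV).
have := Ck_on_mul oU CVV (ch v); apply: Ck_on_eq => // x Ux.
rewrite deriveV; [|exact: h0|by apply: diff_derivable; exact: dh].
by rewrite /GRing.scale /= -exprVn expr2 mulN1r mulNr.
Qed.

(** No induction here: D_v (ln h) = (1/h) D_v h is a product of C^k functions
    as soon as h is C^(k+1). *)
Lemma Ck_on_ln (R : realType) (V : normedModType R) k (U : set V) (h : V -> R) :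
  open U -> (forall x, U x -> 0 < h x) ->
  Ck_on k U h -> Ck_on k U (fun x => ln (h x)).
Proof.
move=> oU h0; case: k => [|k] Ch.
  move=> x Ux; apply: (@continuous_comp _ _ _ h (@ln R) x); first exact: Ch.
  by apply: continuous_ln; exact: h0.
have [dh ch] := Ch.
have dln x : U x -> differentiable (@ln R) (h x).
  by move=> Ux; apply/derivable1_diffP; have [] := is_derive1_ln (h0 x Ux).
have dlnh x : U x -> differentiable (@ln R \o h) x.
  by move=> Ux; apply: differentiable_comp; [exact: dh|exact: dln].
split=> [x Ux|v]; first exact: dlnh.
have CV := Ck_on_inv oU (fun x Ux => lt0r_neq0 (h0 x Ux)) (Ck_on_pred Ch).
have := Ck_on_mul oU CV (ch v); apply: Ck_on_eq => // x Ux.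
rewrite (deriveE _ (dlnh x Ux)) diff_comp; [|exact: dh|exact: dln].
rewrite /= (deriveE _ (dh x Ux)) diff1E; last exact: dln.
rewrite derive1E (@derive_val _ _ _ _ _ _ _ (is_derive1_ln (h0 x Ux))).
by rewrite /GRing.scale /= mulrC.
Qed.

(** The domain on which a map read in two charts is meaningful is open, which
    [Ck_on_comp_lin] requires. *)
Lemma open_chart_preimage (R : realType) (S T : topologicalType) m n
    (c : chart R S m) (d : chart R T n) (F : S -> T) :
  continuous F -> open (cmap c @` (cdom c `&` F @^-1` cdom d)).
Proof.
move=> cF; rewrite openE => _ [p [cp dp] <-].
have cx : (cmap c @` cdom c) (cmap c p) by exists p.
have oF : open (F @^-1` cdom d) by apply: (continuousP _).1 => //; exact: cdom_open.
have H : nbhs (cmap c p) (cinv c @^-1` (F @^-1` cdom d)).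
  by apply: (cinv_continuous cx); rewrite cmapK//; exact: open_nbhs_nbhs.
have H' : nbhs (cmap c p) (cmap c @` cdom c).
  by apply: open_nbhs_nbhs; split => //; exact: cimg_open.
apply: filterS (filterI H H') => x [/= dx [q cq qx]].
by exists q => //; split => //; rewrite /= -[q](cmapK cq) qx.
Qed.

Lemma smooth_map_comp_snd (R : realType) n1 n2 n3 (M1 : manifold R n1)
    (M2 : manifold R n2) (M3 : manifold R n3) (F : M2 -> M3) :
  smooth_map F ->
  @smooth_map R _ _ (prod_manifold M1 M2) M3 (F \o @snd M1 M2).
Proof.
move=> [cF sF]; split.
  by move=> p; apply: continuous_comp; [exact: cvg_snd|exact: cF].
move=> _ d [c1 a1 [c2 a2 <-]] ad k.
have oU := @open_chart_preimage _ _ _ _ _ c2 d F cF.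
have := Ck_on_comp_lin oU (@continuous_rsubmx R 1 n1 n2) (sF c2 d a2 ad k).
apply: Ck_on_sub => _ [p [[/= p1 p2] q] <-].
by rewrite /= row_mxKr; exists p.2.
Qed.

Lemma smooth_fun_comp_fst (R : realType) n1 n2 (M1 : manifold R n1)
    (M2 : manifold R n2) (h : M1 -> R) :
  smooth_fun h -> @smooth_fun R _ (prod_manifold M1 M2) (h \o @fst M1 M2).
Proof.
move=> sh _ [c1 a1 [c2 a2 <-]] k.
have o1 : open (cimg c1) by exact: cimg_open.
have := Ck_on_comp_lin o1 (@continuous_lsubmx R 1 n1 n2) (sh c1 a1 k).
by apply: Ck_on_sub; rewrite [cimg _]prod_chart_img => x [].
Qed.

Lemma smooth_fun_ln (R : realType) n (M : manifold R n) (h : M -> R) :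
  (forall p, 0 < h p) -> smooth_fun h -> smooth_fun (fun p => ln (h p)).
Proof.
move=> h0 sh c ac k; apply: Ck_on_ln (sh c ac k); first exact: cimg_open.
by move=> x _; exact: h0.
Qed.

Lemma tmap_comp_snd (R : realType) n1 n2 n3 (M1 : manifold R n1)
    (M2 : manifold R n2) (M3 : manifold R n3) (F : M2 -> M3)
    (p : prod_manifold M1 M2) (X : tangent p) :
  smooth_map F ->
  @tmap R _ _ (prod_manifold M1 M2) M3 (F \o @snd M1 M2) p X =
  tmap F p.2 (rsubmx (X : 'rV[R]_(n1 + n2))).
Proof.
move=> [_ sF].
pose G := cmap (chart_at (F p.2)) \o F \o cinv (chart_at p.2).
have xr : rsubmx (cmap (chart_at p) p) = cmap (chart_at p.2) p.2.
  by rewrite /= row_mxKr.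
have dG : differentiable G (rsubmx (cmap (chart_at p) p)).
  have [+ _] := sF _ _ (atlas_chart_at p.2) (atlas_chart_at (F p.2)) 1%N.
  apply; rewrite xr; exists p.2 => //.
  by split; exact: chart_at_dom.
have dr : differentiable (rsubmx : 'rV[R]_(n1 + n2) -> _) (cmap (chart_at p) p).
  exact: differentiable_rsubmx.
rewrite /tmap -[in RHS]xr.
(* On the product chart the coordinate form of F \o snd is G \o rsubmx by mere
   unfolding, so no argument on neighbourhoods is involved. *)
transitivity ('d (G \o rsubmx) (cmap (chart_at p) p) X) => //.
by rewrite (diff_comp dr dG) /= (diff_lin _ (@continuous_rsubmx R 1 n1 n2)).
Qed.

Section Metric.
Context (R : realType) (n : nat) (M : riemannian R n).
Implicit Type p : M.

Lemma metricDl p (X Y Z : tangent p) :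
  rmetric M p (X + Y) Z = rmetric M p X Z + rmetric M p Y Z.
Proof. by rewrite -[X]scale1r metric_linear mul1r scale1r. Qed.

Lemma metric0r p (X : tangent p) : rmetric M p X 0 = 0.
Proof.
by apply: (addrI (rmetric M p 0 X)); rewrite (Defs.metric_sym (rmetric M) X) -metricDl !addr0.
Qed.

Lemma metric_sqrD p (X Y : tangent p) :
  rmetric M p (X + Y) (X + Y) =
  rmetric M p X X + 2 * rmetric M p X Y + rmetric M p Y Y.
Proof.
rewrite metricDl ![rmetric M p _ (X + Y)]Defs.metric_sym !metricDl.
by rewrite (Defs.metric_sym (rmetric M) Y X); ring.
Qed.

Lemma metric_nondegenerate p (X : tangent p) :
  (forall V, rmetric M p X V = 0) -> X = 0.
Proof.
move=> H; apply/eqP; apply: contraT => /(metric_pos (rmetric M)).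
by rewrite H ltxx.
Qed.

End Metric.

Lemma horizontalD (R : realType) m n (M : riemannian R m) (N : riemannian R n)
    (F : M -> N) (p : M) (X Y : tangent p) :
  horizontal F X -> horizontal F Y -> horizontal F (X + Y).
Proof. by move=> hX hY V FV; rewrite metricDl hX// hY// addr0. Qed.

(** Polarization: compare the squared lengths of X, Y and X + Y, all three of
    which are horizontal. *)
Lemma riemannian_submersion_metric (R : realType) m n (M : riemannian R m)
    (N : riemannian R n) (F : M -> N) (p : M) (X Y : tangent p) :
  riemannian_submersion F -> horizontal F X -> horizontal F Y ->
  rmetric N (F p) (tmap F p X) (tmap F p Y) = rmetric M p X Y.
Proof.
move=> [_ iF] hX hY.
have E (Z : tangent p) : horizontal F Z ->
    rmetric N (F p) (tmap F p Z) (tmap F p Z) = rmetric M p Z Z.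
  by move=> /iF /eqP; rewrite eqr_sqrt ?metric_ge0// => /eqP.
have := E _ (horizontalD hX hY).
by rewrite linearD !metric_sqrD (E X)// (E Y)//; lra.
Qed.

Section HorizontalWarped.
Context (R : realType) (n1 n2 n3 : nat).
Context (M1 : riemannian R n1) (M2 : riemannian R n2) (M3 : riemannian R n3).
Context (f : M1 -> R) (f_smooth : smooth_fun f) (f_gt0 : forall p, 0 < f p).
Context (F : M2 -> M3) (sF : smooth_map F).
Local Notation M := (@warped_product R n1 n2 M1 M2 f f_smooth f_gt0).

Lemma warped_metricE (p : M) (X Y : 'rV[R]_(n1 + n2)) :
  rmetric M p X Y =
  rmetric M1 p.1 (lsubmx X) (lsubmx Y) +
  f p.1 ^+ 2 * rmetric M2 p.2 (rsubmx X) (rsubmx Y).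
Proof. by rewrite /= /warped_val !tmap_fst !tmap_snd. Qed.

(** Test the orthogonality condition against the two kinds of vertical vectors
    (v, 0) and (0, w), with w vertical for F. *)
Lemma horizontal_comp_snd (p : M) (X : 'rV[R]_(n1 + n2)) :
  @horizontal R _ _ M M3 (F \o @snd M1 M2) p X ->
  lsubmx X = 0 /\ @horizontal R _ _ M2 M3 F p.2 (rsubmx X).
Proof.
move=> hX.
have XE (v : 'rV[R]_n1) (w : 'rV[R]_n2) : tmap F p.2 w = 0 ->
    rmetric M1 p.1 (lsubmx X) v + f p.1 ^+ 2 * rmetric M2 p.2 (rsubmx X) w = 0.
  move=> w0; have := hX (row_mx v w).
  by rewrite tmap_comp_snd// warped_metricE row_mxKl row_mxKr; exact.
split=> [|w w0].
  apply: (@metric_nondegenerate _ _ M1 p.1) => v.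
  by have := XE v 0 (linear0 _); rewrite metric0r mulr0 addr0.
have := XE 0 w w0; rewrite metric0r add0r.
by move=> /eqP; rewrite mulf_eq0 expf_eq0 /= gt_eqF//= => /eqP.
Qed.

End HorizontalWarped.

Theorem theorem9 (R : realType) (n1 n2 n3 : nat)
    (M1 : riemannian R n1) (M2 : riemannian R n2) (M3 : riemannian R n3)
    (f : M1 -> R) (f_smooth : smooth_fun f) (f_gt0 : forall p : M1, 0 < f p)
    (f1 : M2 -> M3) :
  riemannian_submersion f1 ->
  @horizontally_conformal_submersion R (n1 + n2) n3
    (@warped_product R n1 n2 M1 M2 f f_smooth f_gt0) M3 (f1 \o @snd M1 M2).
Proof.
move=> rf1; have [[sf1 surj1 sub1] _] := rf1; split.
  split; first exact: smooth_map_comp_snd.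
    move=> q; have [p2 <-] := surj1 q.
    by have [p1 _] := manifold_nonempty M1; exists (p1, p2).
  move=> p Y; have [X <-] := sub1 p.2 Y.
  by exists (row_mx 0 X : 'rV[R]_(n1 + n2)); rewrite tmap_comp_snd// row_mxKr.
exists (fun p => ln (f p.1)).
  exact: (smooth_fun_comp_fst (smooth_fun_ln f_gt0 f_smooth)).
move=> p X Y /(horizontal_comp_snd sf1)[X0 hX] /(horizontal_comp_snd sf1)[Y0 hY].
rewrite !tmap_comp_snd//.
rewrite [X in _ = _ * X](riemannian_submersion_metric rf1 hX hY).
rewrite expRM_natl lnK ?posrE// warped_metricE X0.
by rewrite (Defs.metric_sym (rmetric M1)) metric0r add0r.
Qed.
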